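(* Let $\alpha \in \mathbb{R}_{>0}$ be an algebraic number such that the additive monoid $\mathbb{N}_0[\alpha]$ is atomic. Then $\rho(\mathbb{N}_0[\alpha]) < \infty$ if and only if $\mathbb{N}_0[\alpha]$ is finitely generated as a monoid.
   Context: $\mathbb{N}_0$ denotes the nonnegative integers. Algebraic numbers are algebraic over $\mathbb{Q}$. For a positive real $\alpha$, $\mathbb{N}_0[\alpha] := \{f(\alpha) \mid f(X) \in \mathbb{N}_0[X]\}$, where $\mathbb{N}_0[X]$ is the set of polynomials with coefficients in $\mathbb{N}_0$; it is regarded as an additive submonoid of $\mathbb{R}_{\ge 0}$. Let $M$ be a cancellative commutative monoid, written additively, whose only invertible element is $0$, and let $M^\bullet = M \setminus \{0\}$. An atom of $M$ is a nonzero $a \in M$ such that $a = b + c$ with $b, c \in M$ implies $b = 0$ or $c = 0$. $M$ is atomic if every nonzero element is a finite sum of atoms. For $M$ atomic and $x \in M^\bullet$, $\mathsf{L}(x)$ is the set of all $\ell \in \mathbb{N}_0$ such that $x = a_1 + \dots + a_\ell$ for some atoms $a_1, \dots, a_\ell$ (repetitions allowed). The elasticity of $x$ is $\rho(x) := \sup \mathsf{L}(x) / \min \mathsf{L}(x)$ (equal to $\infty$ if $\mathsf{L}(x)$ is unbounded), and the elasticity of $M$ is $\rho(M) := \sup\{\rho(x) \mid x \in M^\bullet\}\in \mathbb{R}_{\ge 1} \cup \{\infty\}$. *)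

(* Defs.v *)
From mathcomp Require Import all_boot all_order all_algebra.
From mathcomp Require Import all_classical all_reals all_analysis.

Set Implicit Arguments.
Unset Strict Implicit.
Unset Printing Implicit Defensive.
Import Order.TTheory GRing.Theory Num.Theory.
Local Open Scope classical_set_scope.
Local Open Scope ring_scope.

(* A monoid is represented by its carrier [M : set V], a submonoid of the
   additive monoid [V].  The factorization notions below are intended for [M]
   cancellative with [0] as only invertible element. *)

Definition submonoid (V : nmodType) (M : set V) : Prop :=
  M 0 /\ (forall x y, M x -> M y -> M (x + y)).

Definition finitely_generated (V : nmodType) (M : set V) : Prop :=
  exists2 G : set V, finite_set G & smallest (@submonoid V) G = M.

Definition atom (V : nmodType) (M : set V) (a : V) : Prop :=
  [/\ M a, a != 0 &
      forall b c, M b -> M c -> a = b + c -> b = 0 \/ c = 0].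

(* A factorization of [x] is a sequence of atoms with sum [x]. *)
Definition factorization (V : nmodType) (M : set V) (x : V) (s : seq V) : Prop :=
  {in s, forall a, atom M a} /\ x = \sum_(a <- s) a.

Definition atomic (V : nmodType) (M : set V) : Prop :=
  forall x, M x -> x != 0 -> exists s : seq V, factorization M x s.

Definition lengths (V : nmodType) (M : set V) (x : V) : set nat :=
  [set size s | s in factorization M x].

(* For [M] atomic and [x] a nonzero element of [M], the set of lengths is a
   nonempty set of positive integers, so that the infimum in the denominator is
   a minimum, and is a positive real number. *)
Definition elt_elasticity (R : realType) (V : nmodType) (M : set V) (x : V) :
    \bar R :=
  let L : set (\bar R) := [set (l%:R)%:E | l in lengths M x] in
  (ereal_sup L / ereal_inf L)%E.

Definition elasticity (R : realType) (V : nmodType) (M : set V) : \bar R :=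
  ereal_sup [set elt_elasticity R M x | x in [set x | M x /\ x != 0]].

Definition N0_adjoin (R : realType) (alpha : R) : set R :=
  [set (map_poly (fun n : nat => n%:R) f).[alpha] | f in [set: {poly nat}]].

(* Main.v *)
Require Import Defs.
From mathcomp Require Import all_boot all_order all_algebra.
From mathcomp Require Import all_classical all_reals all_analysis.

(** For an atomic monoid, being finitely generated means having finitely many
    atoms: every generating set contains all atoms ([fg_finite_atoms]), and the
    atoms generate ([atomic_finite_atoms_fg]).  So the theorem compares finite
    elasticity with finiteness of the set of atoms.

    If the atoms are finitely many positive reals, they all lie in some interval
    [[C^-1, C]], so a factorization of [x] has between [x / C] and [C * x]
    atoms, and no element has elasticity above [C ^ 2]
    ([finite_atoms_elasticity]).

    Conversely, every atom of N_0[alpha] is a power of alpha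
    ([atom_N0_adjoin_Xn]), and as soon as one power is not an atom, neither are
    the higher ones, so that infinitely many atoms can only occur when all
    powers of alpha are atoms ([nonatom_Xn_finite_atoms]).  Evaluating at alpha
    a polynomial [f] with natural coefficients then yields a factorization of
    length [f(1)] ([lengths_N0eval]).  If alpha is algebraic and different from
    1, some rational polynomial vanishes at alpha but not at 1; separating its
    positive and negative coefficients gives [p] and [q] with natural
    coefficients such that [p(alpha) = q(alpha)] and, say, [p(1) < q(1)]
    ([algebraic_nat_relation]).  The element [p(alpha) ^ k = q(alpha) ^ k] has
    factorizations of lengths [p(1) ^ k] and [q(1) ^ k], hence elasticity at
    least [(q(1) / p(1)) ^ k], which is unbounded in [k].  For [alpha = 1] the
    only possible atom is 1. *)

Set Implicit Arguments.
Unset Strict Implicit.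
Unset Printing Implicit Defensive.
Import Order.TTheory GRing.Theory Num.Theory.
Local Open Scope classical_set_scope.
Local Open Scope ring_scope.

(** * Atoms and generators *)

Lemma submonoid_sum (V : nmodType) (M : set V) (s : seq V) :
  submonoid M -> {in s, forall a, M a} -> M (\sum_(a <- s) a).
Proof.
move=> [M0 MD] sM; rewrite big_seq.
by apply: (big_ind M) => // a; apply: sM.
Qed.

(** Removing an atom from [M] leaves a submonoid, because an atom is not a sum
    of two nonzero elements; hence no generating set can avoid an atom. *)
Lemma fg_finite_atoms (V : nmodType) (M : set V) :
  finitely_generated M -> finite_set (atom M).
Proof.
move=> [G Gfin GM]; apply: (sub_finite_set _ Gfin) => a [Ma a0 aP].
have [M0 MD] : submonoid M.
  rewrite -GM; split => [N [[]//]|x y Nx Ny N NP].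
  by have [[_ ND] _] := NP; apply: ND; [apply: Nx|apply: Ny].
apply: contrapT => Ga.
suff /(_ a) : M `<=` M `\ a by move=> /(_ Ma)[_]; apply.
rewrite -{1}GM; apply: smallest_sub.
  split=> [|x y [Mx xa] [My ya]]; first by split=> // a0'; rewrite -a0' eqxx in a0.
  split=> [|xya]; first exact: MD.
  by have [x0|y0] := aP x y Mx My (esym xya);
    [apply: ya; rewrite -xya x0 /= add0r|apply: xa; rewrite -xya y0 /= addr0].
move=> g Gg; split=> [|ga]; last by apply: Ga; rewrite -ga.
by rewrite -GM; apply: sub_gen_smallest.
Qed.

Lemma atomic_finite_atoms_fg (V : nmodType) (M : set V) :
  submonoid M -> atomic M -> finite_set (atom M) -> finitely_generated M.
Proof.
move=> subM atM fin; exists (atom M) => //; apply/seteqP; split.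
  by apply: smallest_sub => // a [].
move=> x Mx N [subN atN]; have [->|x0] := eqVneq x 0; first by case: subN.
have [s [sat ->]] := atM x Mx x0.
by apply: submonoid_sum => // a /sat/atN.
Qed.

(** * Elasticity and the size of atoms *)

(** One constant serves as upper bound and, inverted, as lower bound; adding
    both [b] and [b^-1] to it accommodates a further element [b]. *)
Lemma seq_pos_bounds (R : realType) (s : seq R) :
  exists2 C : R, 0 < C & {in s, forall a, 0 < a -> C^-1 <= a <= C}.
Proof.
elim: s => [|b s [C C0 sC]]; first by exists 1.
have [b0|b0] := ltP 0 b; last first.
  exists C => // a; rewrite inE => /predU1P[->|/sC//].
  by rewrite ltNge b0.
have bV0 : 0 < b^-1 by rewrite invr_gt0.
have D0 : 0 < C + b + b^-1 by rewrite !addr_gt0.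
exists (C + b + b^-1) => // a; rewrite inE => /predU1P[-> _|/sC aC a0].
  apply/andP; split; last by rewrite -addrA addrCA lerDl addr_ge0// ltW.
  by rewrite -[leRHS]invrK lef_pV2// lerDr addr_ge0// ltW.
have /andP[Ca aC'] := aC a0; apply/andP; split.
  by apply: le_trans Ca; rewrite lef_pV2// -addrA lerDl ltW// addr_gt0.
by apply: (le_trans aC'); rewrite -addrA lerDl ltW// addr_gt0.
Qed.

(** With all atoms in [[C^-1, C]], the length of a factorization of [x] is
    determined by [x] up to a factor [C] on each side. *)
Lemma finite_atoms_elasticity (R : realType) (M : set R) :
  (forall x, M x -> 0 <= x) -> atomic M -> finite_set (atom M) ->
  (elasticity R M < +oo)%E.
Proof.
move=> M0 atM /finite_seqP[s sE].
have [C C0 sC] := seq_pos_bounds s.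
have aC a : atom M a -> C^-1 <= a <= C.
  move=> aat; have [Ma a0 _] := aat.
  by apply: sC; [rewrite sE in aat|rewrite lt_neqAle eq_sym a0 M0].
apply: (@le_lt_trans _ _ (C * C)%:E); last by rewrite ltry.
apply: ge_ereal_sup => _ [x [Mx x0] <-].
have xgt0 : 0 < x by rewrite lt_neqAle eq_sym x0 M0.
have Lx l : lengths M x l -> C^-1 * x <= l%:R <= C * x.
  move=> [t [tat ->] <-].
  elim: t tat => [|a t IHt] tat; first by rewrite big_nil !mulr0 lexx.
  have /andP[Ca aC'] := aC a (tat a (mem_head _ _)).
  have /andP[Ct tC] := IHt (fun b bt => tat b (mem_behead (s := a :: t) bt)).
  rewrite big_cons !mulrDr -[size _]/(size t).+1 -natr1 addrC.
  apply/andP; split.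
    by apply: lerD => //; rewrite mulrC ler_pdivrMr// mul1r.
  rewrite addrC; apply: lerD => //.
  by rewrite mulrC -ler_pdivrMr// mul1r.
rewrite /elt_elasticity; set L := [set _ | _ in _].
have [t xt] := atM x Mx x0.
have Lt : L (size t)%:R%:E by exists (size t) => //; exists t.
have CxV : (C^-1 * x)^-1 = C / x by rewrite invfM invrK.
have infL : ((C^-1 * x)%:E <= ereal_inf L)%E.
  by apply: le_ereal_inf_tmp => _ [l /Lx/andP[? _] <-]; rewrite lee_fin.
have supL : (ereal_sup L <= (C * x)%:E)%E.
  by apply: ge_ereal_sup => _ [l /Lx/andP[_ ?] <-]; rewrite lee_fin.
have Cx0 : 0 < C^-1 * x by rewrite mulr_gt0// invr_gt0.
have inf0 : (0 <= ereal_inf L)%E by apply: le_trans infL; rewrite lee_fin ltW.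
have -> : ((C * C)%:E = (C * x)%:E * ((C^-1 * x)%:E)^-1)%E.
  rewrite inver gt_eqF// -EFinM CxV; congr EFin.
  by rewrite mulrCA -!mulrA divff// mulr1.
apply: lee_pmul => //.
- by apply: le_trans (ereal_sup_ubound Lt); rewrite lee_fin.
- by rewrite inve_ge0.
- by rewrite lee_pV2// inE// lee_fin ltW.
Qed.

(** Since [x] is nonzero its lengths are at least 1, so the infimum in the
    denominator is positive and inverting it reverses inequalities. *)
Lemma le_elt_elasticity (R : realType) (V : nmodType) (M : set V) (x : V)
    (l m : nat) :
  x != 0 -> lengths M x l -> lengths M x m ->
  ((l%:R / m%:R)%:E <= elt_elasticity R M x)%E.
Proof.
move=> x0 Ll Lm.
have len_gt0 k : lengths M x k -> (0 < k)%N.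
  by move=> [[|a t] [_ xE] <- //]; rewrite xE big_nil eqxx in x0.
rewrite /elt_elasticity; set L := [set _ | _ in _].
have inf1 : (1 <= ereal_inf L)%E.
  apply: le_ereal_inf_tmp => _ [k /len_gt0 k0 <-].
  by rewrite lee_fin ler1n.
have m0 : m%:R != 0 :> R by rewrite pnatr_eq0 -lt0n len_gt0.
have -> : ((l%:R / m%:R)%:E = l%:R%:E * (m%:R%:E)^-1 :> \bar R)%E.
  by rewrite inver (negbTE m0).
have inf0 : (0 <= ereal_inf L)%E by apply: le_trans inf1.
apply: lee_pmul.
- by rewrite lee_fin.
- by rewrite inve_ge0 lee_fin.
- by apply: ereal_sup_ubound; exists l.
- by rewrite lee_pV2 ?inE ?lee_fin//; apply: ereal_inf_lbound; exists m.
Qed.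

Lemma exprn_unbounded (R : realType) (r B : R) :
  1 < r -> exists k : nat, B < r ^+ k.
Proof.
move=> r1; have r10 : 0 < r - 1 by rewrite subr_gt0.
have bernoulli k : k%:R * (r - 1) < r ^+ k.
  elim: k => [|k IHk]; first by rewrite mul0r expr0.
  have rk : 1 <= r ^+ k by rewrite exprn_ege1// ltW.
  rewrite -natr1 mulrDl mul1r exprS -[X in _ < X * _](subrK 1).
  rewrite [ltRHS]mulrDl mul1r addrC.
  by rewrite ler_ltD// ler_peMr// ltW.
exists (Num.bound `|B / (r - 1)|); apply: le_lt_trans (bernoulli _).
rewrite -ler_pdivrMr//; apply: le_trans (ler_norm _) _.
by rewrite ltW// archi_boundP.
Qed.

(** * Polynomials with natural coefficients *)

(** The form in which the nonnegativity of the coefficients gets used: a nonzero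
    polynomial contains a monomial that can be split off. *)
Lemma poly_nat_split (f : {poly nat}) :
  f != 0 -> exists i g, f = 'X^i + g.
Proof.
elim/poly_ind: f => [|f [|c] IHf]; first by rewrite eqxx.
- rewrite polyC0 addr0 => fX0; have /IHf[i [g ->]] : f != 0.
    by apply: contra_neq fX0 => ->; rewrite mul0r.
  by exists i.+1, (g * 'X); rewrite mulrDl exprSr.
- move=> _; exists 0%N, (f * 'X + c%:P).
  by rewrite expr0 addrCA -polyCD.
Qed.

(** Separating positive and negative coefficients turns an integer relation into
    an equality between two polynomials with natural coefficients. *)
Lemma poly_int_split (f : {poly int}) :
  exists p q : {poly nat}, f = map_poly Posz p - map_poly Posz q.
Proof.
elim/poly_ind: f => [|f c [p [q ->]]]; first by exists 0, 0; rewrite subrr.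
have [a [b ->]] : exists a b : nat, c = a%:Z - b%:Z.
  by case: c => n; [exists n, 0%N; rewrite subr0|exists 0%N, n.+1; rewrite sub0r NegzE].
exists (p * 'X + a%:P), (q * 'X + b%:P).
rewrite !rmorphD !rmorphM /= !map_polyX !map_polyC /= rmorphN /=.
by rewrite mulrBl opprD addrACA.
Qed.

Section Evaluation.
Variables (R : realType) (alpha : R).

(* The cast of natural numbers, packaged as a morphism of semirings. *)
Let natrm : {rmorphism nat -> R} := (intmul 1 : {rmorphism int -> R}) \o Posz.

Definition N0eval (f : {poly nat}) : R :=
  (map_poly (fun n : nat => n%:R) f).[alpha].

Let N0evalE f : N0eval f = (map_poly natrm f).[alpha]. Proof. by []. Qed.

Lemma N0evalD f g : N0eval (f + g) = N0eval f + N0eval g.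
Proof. by rewrite !N0evalE rmorphD hornerD. Qed.

Lemma N0evalM f g : N0eval (f * g) = N0eval f * N0eval g.
Proof. by rewrite !N0evalE rmorphM hornerM. Qed.

Lemma N0eval_exp f k : N0eval (f ^+ k) = N0eval f ^+ k.
Proof. by rewrite !N0evalE rmorphXn horner_exp. Qed.

Lemma N0eval0 : N0eval 0 = 0.
Proof. by rewrite N0evalE rmorph0 horner0. Qed.

Lemma N0evalC n : N0eval n%:P = n%:R.
Proof. by rewrite N0evalE map_polyC hornerC. Qed.

Lemma N0evalX : N0eval 'X = alpha.
Proof. by rewrite N0evalE map_polyX hornerX. Qed.

Lemma N0evalXn k : N0eval 'X^k = alpha ^+ k.
Proof. by rewrite N0eval_exp N0evalX. Qed.

End Evaluation.

(** * The monoid N_0[alpha] *)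

Section Adjoin.
Variables (R : realType) (alpha : R).
Hypothesis alpha_gt0 : 0 < alpha.

Local Notation M := (N0_adjoin alpha).
Local Notation ev := (N0eval alpha).

Lemma N0_adjoin_submonoid : submonoid M.
Proof.
split=> [|_ _ [f _ <-] [g _ <-]]; first by exists 0 => //; apply: N0eval0.
by exists (f + g) => //; apply: N0evalD.
Qed.

Lemma N0_adjoinM x y : M x -> M y -> M (x * y).
Proof. by move=> [f _ <-] [g _ <-]; exists (f * g) => //; apply: N0evalM. Qed.

Lemma N0_adjoinXn i : M (alpha ^+ i).
Proof. by exists 'X^i => //; apply: N0evalXn. Qed.

Lemma N0eval_ge0 f : 0 <= ev f.
Proof.
elim/poly_ind: f => [|f c IHf]; first by rewrite N0eval0.
by rewrite N0evalD N0evalM N0evalX N0evalC addr_ge0// mulr_ge0// ltW.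
Qed.

Lemma N0_adjoin_ge0 x : M x -> 0 <= x.
Proof. by move=> [f _ <-]; apply: N0eval_ge0. Qed.

Lemma N0eval_gt0 f : f != 0 -> 0 < ev f.
Proof.
move=> /poly_nat_split[i [g ->]].
by rewrite N0evalD N0evalXn ltr_wpDr ?N0eval_ge0// exprn_gt0.
Qed.

(** Splitting a monomial off [f] writes [f(alpha)] as a power of alpha plus an
    element of the monoid; for an atom the latter must vanish. *)
Lemma atom_N0_adjoin_Xn a : atom M a -> exists i, a = alpha ^+ i.
Proof.
move=> [[f _ <-]]; rewrite -/(ev f) => f0 aP.
have /poly_nat_split[i [g fE]] : f != 0.
  by apply: contra_neq f0 => ->; rewrite N0eval0.
exists i; move: (aP (alpha ^+ i) (ev g)); rewrite fE N0evalD N0evalXn.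
case=> [||//||->]; rewrite ?addr0//.
- exact: N0_adjoinXn.
- by exists g.
- by move/eqP; rewrite gt_eqF// exprn_gt0.
Qed.

(** A decomposition of [alpha ^ n], multiplied by [alpha ^ (i - n)], decomposes
    [alpha ^ i]; so only the powers below [n] can be atoms. *)
Lemma nonatom_Xn_finite_atoms n :
  ~ atom M (alpha ^+ n) -> finite_set (atom M).
Proof.
move=> nat_n; apply: (@sub_finite_set _ _ ((fun i => alpha ^+ i) @` `I_n)).
  move=> a aat; have [i aE] := atom_N0_adjoin_Xn aat.
  exists i => //=; rewrite ltnNge; apply/negP => le_ni.
  apply: nat_n; have [_ _ aP] := aat.
  have ai : alpha ^+ i = alpha ^+ (i - n) * alpha ^+ n by rewrite -exprD subnK.
  have pos k : alpha ^+ k != 0 by rewrite gt_eqF// exprn_gt0.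
  split=> [||b c Mb Mc bc]; [exact: N0_adjoinXn|exact: pos|].
  have := aP (alpha ^+ (i - n) * b) (alpha ^+ (i - n) * c).
  rewrite -mulrDr -bc -ai aE.
  by case=> //; [exact: N0_adjoinM (N0_adjoinXn _) _
    |exact: N0_adjoinM (N0_adjoinXn _) _|move/eqP|move/eqP];
    rewrite mulf_eq0 (negbTE (pos _)) => /eqP; [left|right].
by apply: finite_image; apply: finite_II.
Qed.

(** The value [f(1)] counts the monomials of [f] with multiplicity, and each of
    them contributes one atom. *)
Lemma lengths_N0eval f :
  (forall n, atom M (alpha ^+ n)) -> lengths M (ev f) f.[1%N].
Proof.
move=> at_n.
suff [s -> <-] : exists2 s : seq nat,
    ev f = \sum_(i <- s) alpha ^+ i & size s = f.[1%N].
  exists [seq alpha ^+ i | i <- s]; last by rewrite size_map.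
  by split; [move=> _ /mapP[i _ ->]|rewrite big_map].
elim/poly_ind: f => [|f c [s sE sz]].
  by exists [::]; rewrite ?big_nil ?N0eval0 ?horner0.
exists ([seq i.+1 | i <- s] ++ nseq c 0%N).
  rewrite N0evalD N0evalM N0evalX N0evalC sE big_cat big_map big_nseq.
  congr (_ + _); last by rewrite iter_addr_0 expr0.
  by rewrite mulr_suml; apply: eq_bigr => i _; rewrite exprSr.
by rewrite hornerMXaddC mulr1 size_cat size_map size_nseq sz.
Qed.

End Adjoin.

(** Dividing an annihilating polynomial of alpha by the largest possible power of
    [X - 1] keeps alpha as a root and makes the value at 1 nonzero, which is
    what makes the two sides have different numbers of monomials. *)
Lemma algebraic_nat_relation (R : realType) (alpha : R) :
  0 < alpha -> alpha != 1 -> algebraicOver (ratr : rat -> R) alpha ->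
  exists p q : {poly nat},
    [/\ N0eval alpha p = N0eval alpha q, p != 0 & (p.[1%N] < q.[1%N])%N].
Proof.
move=> alpha_gt0 alpha1 [h h0 ha].
have [m [g /implyP/(_ h0) g1 hE]] := multiplicity_XsubC h 1.
have {}ga : root (map_poly (ratr : rat -> R) g) alpha.
  move: ha; rewrite hE rmorphM rmorphXn rmorphB /= map_polyX map_polyC /=.
  rewrite rmorph1 rootM => /orP[//|].
  by rewrite /root horner_exp expf_eq0 !hornerE subr_eq0 (negbTE alpha1) andbF.
have [f [a a0 gE]] := rat_poly_scale g.
have [p [q fE]] := poly_int_split f.
have pq : N0eval alpha p = N0eval alpha q.
  have /eqP : (map_poly (intmul 1 : int -> R) f).[alpha] = 0.
    move: ga; rewrite gE /root map_polyZ hornerZ mulf_eq0.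
    rewrite fmorph_eq0 invr_eq0 intr_eq0 (negbTE a0) /=.
    rewrite -map_poly_comp => /eqP <-; congr (_ .[_]).
    by apply: eq_map_poly => z /=; rewrite ratr_int.
  by rewrite fE rmorphB /= hornerD hornerN subr_eq0 -!map_poly_comp => /eqP.
have pq1 : p.[1%N] != q.[1%N].
  apply: contraNneq g1 => pq1.
  rewrite gE fE /root hornerZ -(rmorph1 (intmul 1 : int -> rat)) horner_map.
  rewrite hornerD hornerN -(rmorph1 Posz) !horner_map /= pq1 subrr.
  by rewrite mulr0.
wlog lt_pq : p q {fE} pq pq1 / (p.[1%N] < q.[1%N])%N => [wlog_lt|].
  have [lt_pq|lt_qp|e] := ltngtP p.[1%N] q.[1%N]; first exact: (wlog_lt p q).
    by apply: (wlog_lt q p) => //; rewrite eq_sym.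
  by rewrite e eqxx in pq1.
exists p, q; split=> //; apply: contraTneq lt_pq => p0.
move: pq; rewrite p0 N0eval0 horner0.
have [->|/(N0eval_gt0 alpha_gt0)] := eqVneq q 0; first by rewrite horner0.
by move=> q_gt0 q0; rewrite -q0 ltxx in q_gt0.
Qed.

Theorem proposition4p2 (R : realType) (alpha : R) (alpha_gt0 : 0 < alpha)
    (alpha_algebraic : algebraicOver (ratr : rat -> R) alpha)
    (alpha_atomic : atomic (N0_adjoin alpha)) :
  (elasticity R (N0_adjoin alpha) < +oo)%E <->
  finitely_generated (N0_adjoin alpha).
Proof.
split=> [fin_el|/fg_finite_atoms fin_at]; last first.
  exact: finite_atoms_elasticity (N0_adjoin_ge0 alpha_gt0) alpha_atomic fin_at.
apply: atomic_finite_atoms_fg => //; first exact: N0_adjoin_submonoid.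
have [alpha1|alpha1] := eqVneq alpha 1.
  apply: (@sub_finite_set _ _ [set 1]) => // a /(atom_N0_adjoin_Xn alpha_gt0).
  by move=> [i ->]; rewrite alpha1 expr1n.
have [[n]|at_n] := pselect (exists n, ~ atom (N0_adjoin alpha) (alpha ^+ n)).
  exact: nonatom_Xn_finite_atoms.
have {}at_n n : atom (N0_adjoin alpha) (alpha ^+ n).
  by apply: contrapT => Xn; apply: at_n; exists n.
have [p [q [pq p0 lt_pq]]] :=
  algebraic_nat_relation alpha_gt0 alpha1 alpha_algebraic.
have p1 : (0 < p.[1%N])%N.
  by have [i [g ->]] := poly_nat_split p0; rewrite hornerD hornerXn expr1n.
have ratio_gt1 : 1 < q.[1%N]%:R / p.[1%N]%:R :> R.
  by rewrite ltr_pdivlMr ?ltr0n// mul1r ltr_nat.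
have [B el_le] : exists B : R, (elasticity R (N0_adjoin alpha) <= B%:E)%E.
  case: (elasticity R (N0_adjoin alpha)) fin_el => [B|//|] _.
    by exists B.
  by exists 0; rewrite leNye.
have [k] := exprn_unbounded B ratio_gt1.
rewrite ltNge => /negP[]; rewrite -lee_fin; apply: le_trans el_le.
have pk0 : N0eval alpha p ^+ k != 0 by rewrite expf_neq0// gt_eqF// N0eval_gt0.
have value1_exp f : (f.[1%N] ^ k)%N = (f ^+ k).[1%N] :> nat.
  by rewrite horner_exp natrXE.
apply: (@le_trans _ _ (elt_elasticity R (N0_adjoin alpha) (N0eval alpha p ^+ k))).
  rewrite expr_div_n -!natrX !value1_exp; apply: le_elt_elasticity => //.
    by rewrite pq -N0eval_exp; apply: lengths_N0eval.
  by rewrite -N0eval_exp; apply: lengths_N0eval.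
apply: ereal_sup_ubound; exists (N0eval alpha p ^+ k) => //; split=> //.
by rewrite -N0eval_exp; exists (p ^+ k).
Qed.
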